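(* Let $n$ be a positive squarefree integer. Suppose $N>1$ is a divisor of $n$ and $T$ is a partition of the set of all positive divisors of $N$ into two-element subsets $\{a_1,b_1\},\{a_2,b_2\},\ldots,\{a_l,b_l\}$. Let $D=\gcd_{1\le i\le l}\bigl(a_i+\mu(a_i)\mu(b_i)b_i\bigr)$. Then the cyclotomic polynomial $\Phi_d$ divides $F_n$ for every positive integer $d\mid D$ such that $d\nmid n$.
   Context: For an integer $n>1$, $F_n(x)=\sum_{0\le a\le n-1,\ \gcd(a,n)=1}x^a\in\mathbb{Z}[x]$ (the Fekete polynomial of the principal Dirichlet character modulo $n$). $\mu$ is the Möbius function and $\Phi_d$ is the $d$-th cyclotomic polynomial. *)

(* Defs.v *)
From HB Require Import structures.
From mathcomp Require Export all_boot all_order all_algebra all_field.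

Set Implicit Arguments.
Unset Strict Implicit.
Unset Printing Implicit Defensive.

Import GRing.Theory.
Local Open Scope ring_scope.

Definition squarefree (n : nat) : bool :=
  (0 < n)%N && all (fun p => ~~ (p ^ 2 %| n)%N) (primes n).

Definition moebius (n : nat) : int :=
  if squarefree n then (-1) ^+ size (primes n) else 0.

Definition fekete (n : nat) : {poly int} :=
  \sum_(a < n | coprime a n) 'X^a.

(* Divisibility in Z[x]. The library's %| on {poly int} is pseudo-divisibility,
   which ignores nonzero integer factors. *)
Definition zpoly_dvd (p q : {poly int}) : Prop := exists r, q = p * r.

(* For N > 0 this is the set of all positive divisors of N: they are all at
   most N, and 0 does not divide N. *)
Definition divisor_set (N : nat) : {set 'I_N.+1} :=
  [set m : 'I_N.+1 | (m %| N)%N].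

(* T is a partition of the divisors of N into the l distinct two-element blocks
   {a_i, b_i}, 0 <= i < l. The order of the blocks and the choice of which
   element of a block is called a_i are arbitrary. *)
Definition divisor_pairing (N l : nat) (a b : 'I_l -> 'I_N.+1)
    (T : {set {set 'I_N.+1}}) : Prop :=
  [/\ partition T (divisor_set N),
      forall B : {set 'I_N.+1}, B \in T -> #|B| = 2%N,
      T = [set [set a i; b i] | i : 'I_l]
    & injective (fun i : 'I_l => [set a i; b i])].

Definition pairing_gcd (N l : nat) (a b : 'I_l -> 'I_N.+1) : int :=
  \big[gcdz/0]_(i < l)
    ((a i)%:Z + moebius (a i) * moebius (b i) * (b i)%:Z).

(* Main.v *)
Require Import Defs.
From HB Require Import structures.
From mathcomp Require Import all_boot all_order all_algebra all_field.
From mathcomp Require Import ring.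

Set Implicit Arguments.
Unset Strict Implicit.
Unset Printing Implicit Defensive.

Import GRing.Theory.
Local Open Scope ring_scope.

(** Let z be a primitive d-th root of unity; as 'Phi_d is its minimal polynomial,
it suffices that F_n(z) = 0 ([Cyclotomic_dvd]).

Detecting coprimality to n by Moebius inversion and summing geometric series
gives ([horner_fekete])
  F_n(z) = (1 - z^n) * \sum_(m | n) mu(m) / (1 - z^m),
where no denominator vanishes because d does not divide n. As n is squarefree,
n = M N with M and N coprime, so each divisor of n is uniquely f e with f | M
and e | N, and the sum splits into inner sums over e, one for each f:
  mu(f) * \sum_(e | N) mu(e) / (1 - w^e),    w = z^f.
Each inner sum vanishes ([sum_pairing_eq0]). Indeed, put
h(e) = mu(e) * (1 / (1 - w^e) - 1 / 2). For a pair {a, b} of the partition,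
either mu(a) = - mu(b) and w^a = w^b, or mu(a) = mu(b) and w^a w^b = 1, in which
case 1 / (1 - w^a) + 1 / (1 - w^b) = 1; both times h(a) + h(b) = 0
([pair_cancel]). So the h(e) add up to 0, and the correction
1/2 * \sum_(e | N) mu(e) is 0 because N > 1. *)

(** * Squarefree numbers and the Moebius function *)

Lemma squarefree_gt0 n : squarefree n -> (0 < n)%N.
Proof. by case/andP. Qed.

Lemma squarefree_dvd m n : (m %| n)%N -> squarefree n -> squarefree m.
Proof.
move=> m_dvd_n /andP[n_gt0 /allP sqf_n]; have m_gt0 := dvdn_gt0 n_gt0 m_dvd_n.
rewrite /squarefree m_gt0; apply/allP => p.
rewrite mem_primes => /and3P[pr_p _ p_dvd_m].
apply: contra (sqf_n p _) => [/dvdn_trans|]; first exact.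
by rewrite mem_primes pr_p n_gt0 (dvdn_trans p_dvd_m).
Qed.

Lemma squarefree_coprime m n : squarefree (m * n) -> coprime m n.
Proof.
case/andP; rewrite muln_gt0 => /andP[m_gt0 n_gt0] /allP sqf_mn.
rewrite coprime_has_primes //; apply/hasPn => p pn; apply/negP => /= pm.
have /negP[] : ~~ (p ^ 2 %| m * n)%N.
  by apply: sqf_mn; rewrite primesM // pn orbT.
move: pn pm; rewrite !mem_primes => /and3P[_ _ ?] /and3P[_ _ ?].
exact: dvdn_mul.
Qed.

Lemma moebius_squarefree n :
  squarefree n -> moebius n = (-1) ^+ size (primes n).
Proof. by rewrite /moebius => ->. Qed.

Lemma size_primesM m n : (0 < m)%N -> (0 < n)%N -> coprime m n ->
  size (primes (m * n)) = (size (primes m) + size (primes n))%N.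
Proof.
move=> m_gt0 n_gt0; rewrite coprime_has_primes // => co_mn.
rewrite -size_cat; apply: perm_size; apply: uniq_perm => [||p].
- exact: primes_uniq.
- by rewrite cat_uniq !primes_uniq co_mn.
- by rewrite mem_cat primesM.
Qed.

Lemma moebiusM m n :
  squarefree (m * n) -> moebius (m * n) = moebius m * moebius n.
Proof.
move=> sqf_mn; have := squarefree_gt0 sqf_mn.
rewrite muln_gt0 => /andP[m_gt0 n_gt0].
have sqf_m : squarefree m by apply: squarefree_dvd sqf_mn; apply: dvdn_mulr.
have sqf_n : squarefree n by apply: squarefree_dvd sqf_mn; apply: dvdn_mull.
by rewrite !moebius_squarefree // size_primesM ?squarefree_coprime ?exprD.
Qed.

Lemma moebius_prime p : prime p -> moebius p = -1.
Proof.
move=> pr_p; have p_gt1 := prime_gt1 pr_p.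
rewrite moebius_squarefree ?primes_prime //.
rewrite /squarefree prime_gt0 // primes_prime //=.
by rewrite andbT gtnNdvd ?prime_gt0 // expnS ltn_Pmulr ?prime_gt0.
Qed.

(** * Sums over divisors *)

(** The factorization of a divisor d of m * n is d = gcdn d m * gcdn d n. *)
Lemma perm_divisorsM m n : (0 < m)%N -> (0 < n)%N -> coprime m n ->
  perm_eq (divisors (m * n)) [seq (x * y)%N | x <- divisors m, y <- divisors n].
Proof.
move=> m_gt0 n_gt0 co_mn; have mn_gt0 : (0 < m * n)%N by rewrite muln_gt0 m_gt0.
apply: uniq_perm => [||d]; first exact: divisors_uniq.
  apply: allpairs_uniq; rewrite ?divisors_uniq // => -[x y] [x' y'].
  case/allpairsP=> -[u v] /= [um vn [-> ->]].
  case/allpairsP=> -[u' v'] /= [um' vn' [-> ->]] eq_uv.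
  have fac s t : s \in divisors m -> t \in divisors n ->
      gcdn m (s * t) = s /\ gcdn n (s * t) = t.
    rewrite -!dvdn_divisors // => s_m t_n; split.
      rewrite Gauss_gcdl; first exact/gcdn_idPr.
      exact: coprime_dvdr co_mn.
    rewrite Gauss_gcdr; first exact/gcdn_idPr.
    by rewrite coprime_sym; apply: coprime_dvdl co_mn.
  have [Du Dv] := fac _ _ um vn; have [Du' Dv'] := fac _ _ um' vn'.
  rewrite /= in eq_uv.
  by congr (_, _); [rewrite -Du eq_uv | rewrite -Dv eq_uv].
rewrite -dvdn_divisors //; apply/idP/allpairsP => [d_mn | [[x y] /= [xm yn ->]]].
  exists (gcdn d m, gcdn d n); rewrite -!dvdn_divisors ?dvdn_gcdr //; split=> //.
  apply/eqP; rewrite eqn_dvd; apply/andP; split; last first.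
    rewrite Gauss_dvd ?dvdn_gcdl // (coprime_dvdl (dvdn_gcdr d m)) //.
    exact: coprime_dvdr (dvdn_gcdr d n) co_mn.
  rewrite /= muln_gcdl dvdn_gcd dvdn_mulr //= muln_gcdr dvdn_gcd d_mn.
  by rewrite dvdn_mull.
by rewrite -!dvdn_divisors // in xm yn; apply: dvdn_mul.
Qed.

Lemma sum_divisorsM (V : nmodType) m n (f : nat -> V) :
    (0 < m)%N -> (0 < n)%N -> coprime m n ->
  \sum_(k <- divisors (m * n)) f k
    = \sum_(x <- divisors m) \sum_(y <- divisors n) f (x * y)%N.
Proof.
move=> m_gt0 n_gt0 co_mn; rewrite -big_allpairs_dep.
by apply: perm_big; apply: perm_divisorsM.
Qed.

Lemma sum_divisors_prime (V : nmodType) p (f : nat -> V) :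
  prime p -> \sum_(k <- divisors p) f k = f 1%N + f p.
Proof.
move=> pr_p; rewrite (perm_big [:: 1%N; p]) /=.
  by rewrite big_cons big_seq1.
apply: uniq_perm => [||d]; rewrite ?divisors_uniq //=.
  by rewrite inE neq_ltn prime_gt1.
rewrite -dvdn_divisors ?prime_gt0 // !inE; case/primeP: pr_p => _ div_p.
by apply/idP/idP => [/div_p | /orP[] /eqP ->]; rewrite ?dvd1n.
Qed.

(** For n > 1, with p a prime factor of n, the divisors x and x * p with
x %| n %/ p have opposite values of the Moebius function. *)
Lemma sum_moebius n :
  squarefree n -> \sum_(m <- divisors n) moebius m = (n == 1%N)%:R.
Proof.
move=> sqf_n; have [-> | n_neq1] := eqVneq n 1%N; first by rewrite big_seq1.
have n_gt0 := squarefree_gt0 sqf_n.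
have n_gt1 : (1 < n)%N by rewrite ltn_neqAle eq_sym n_neq1.
have pr_p := pdiv_prime n_gt1; set p := pdiv n in pr_p.
have [q Dn] := dvdnP (pdiv_dvd n); rewrite -/p in Dn.
rewrite Dn in sqf_n n_gt0 *.
have q_gt0 : (0 < q)%N by move: n_gt0; rewrite muln_gt0 => /andP[].
rewrite sum_divisorsM ?(squarefree_coprime sqf_n) ?(prime_gt0 pr_p) //.
rewrite big1_seq // => x /andP[_].
rewrite -dvdn_divisors // => x_dvd_q.
rewrite sum_divisors_prime // muln1 moebiusM ?(moebius_prime pr_p).
  by rewrite mulrN1 subrr.
by apply: squarefree_dvd sqf_n; rewrite dvdn_mul.
Qed.

Lemma coprime_sum_moebius a n : squarefree n ->
  (coprime a n)%:R = \sum_(m <- divisors n | (m %| a)%N) moebius m.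
Proof.
move=> sqf_n; have n_gt0 := squarefree_gt0 sqf_n.
have g_gt0 : (0 < gcdn a n)%N by rewrite gcdn_gt0 n_gt0 orbT.
rewrite /coprime -sum_moebius ?(squarefree_dvd (dvdn_gcdr a n)) //.
rewrite -[RHS]big_filter; apply: perm_big; apply: uniq_perm => [||m].
- exact: divisors_uniq.
- by rewrite filter_uniq ?divisors_uniq.
by rewrite mem_filter -!dvdn_divisors // dvdn_gcd.
Qed.

Lemma sum_divisor_set (V : nmodType) N (f : nat -> V) : (0 < N)%N ->
  \sum_(e in divisor_set N) f e = \sum_(e <- divisors N) f e.
Proof.
move=> N_gt0; rewrite -big_enum -(big_map val xpredT f); apply: perm_big.
apply: uniq_perm => [||m]; rewrite ?divisors_uniq //.
  by rewrite (map_inj_uniq val_inj) enum_uniq.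
rewrite -dvdn_divisors //; apply/mapP/idP => [[e]|m_dvd_N].
  by rewrite mem_enum inE => ? ->.
have m_le_N : (m < N.+1)%N by rewrite ltnS dvdn_leq.
by exists (Ordinal m_le_N); rewrite ?mem_enum ?inE.
Qed.

(** Blocks have exactly two elements, so a i and b i are distinct and no divisor
is counted twice. *)
Lemma sum_pairing (V : nmodType) N l (a b : 'I_l -> 'I_N.+1) T
    (f : 'I_N.+1 -> V) : divisor_pairing a b T ->
  \sum_(e in divisor_set N) f e = \sum_i (f (a i) + f (b i)).
Proof.
case=> /and3P[/eqP <- tiT _] card2 defT injT.
rewrite big_trivIset //= {1}defT big_imset /=; last first.
  by move=> i j _ _; apply: injT.
apply: eq_bigr => i _; rewrite big_setU1 ?big_set1 //= inE.
have /card2 : [set a i; b i] \in T by rewrite defT; apply/imsetP; exists i.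
by rewrite cards2; case: eqP.
Qed.

Lemma pairing_dvd N l (a b : 'I_l -> 'I_N.+1) T i : divisor_pairing a b T ->
  (a i %| N)%N /\ (b i %| N)%N.
Proof.
case=> /and3P[/eqP covT _ _] _ defT _.
have /subsetP sub : [set a i; b i] \subset divisor_set N.
  rewrite -covT; apply: (bigcup_sup [set a i; b i]) => //.
  by rewrite defT; apply/imsetP; exists i.
have [aN bN] : a i \in divisor_set N /\ b i \in divisor_set N.
  by split; apply: sub; rewrite !inE eqxx ?orbT.
by move: aN bN; rewrite !inE.
Qed.

Lemma pairing_gcd_dvd N l (a b : 'I_l -> 'I_N.+1) i :
  (pairing_gcd a b %| (a i)%:Z + moebius (a i) * moebius (b i) * (b i)%:Z)%Z.
Proof.
rewrite /pairing_gcd; elim: index_enum (mem_index_enum i) => // j s IHs.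
rewrite inE big_cons => /predU1P[<- | /IHs]; first exact: dvdz_gcdl.
exact/dvdz_trans/dvdz_gcdr.
Qed.

(** * Values of the Fekete polynomial at roots of unity *)

Lemma sum_multiples (R : nmodType) m q (f : nat -> R) : (0 < m)%N ->
  \sum_(a < m * q | (m %| a)%N) f a = \sum_(k < q) f (m * k)%N.
Proof.
move=> m_gt0; rewrite -(big_mkord (dvdn m) f).
rewrite -(big_mkord xpredT (fun k => f (m * k)%N)).
rewrite -big_filter -(big_map (muln m) xpredT f); apply: perm_big.
apply: uniq_perm => [||k]; first by rewrite filter_uniq ?iota_uniq.
  rewrite map_inj_uniq ?iota_uniq // => x y /eqP.
  by rewrite eqn_pmul2l // => /eqP.
rewrite mem_filter mem_index_iota; apply/andP/mapP => [[/dvdnP[j ->]]|[j]].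
  rewrite mulnC ltn_pmul2l // => j_q.
  by exists j; rewrite ?mem_index_iota // mulnC.
by rewrite mem_index_iota => j_q ->; rewrite dvdn_mulr // ltn_pmul2l.
Qed.

Lemma sum_expr_multiples (F : fieldType) (z : F) m n :
    (0 < n)%N -> (m %| n)%N -> z ^+ m != 1 ->
  \sum_(a < n | (m %| a)%N) z ^+ a = (1 - z ^+ n) / (1 - z ^+ m).
Proof.
move=> n_gt0 /dvdnP[q Dn] zm1; rewrite mulnC in Dn; subst n.
have m_gt0 : (0 < m)%N by case: (m) n_gt0.
rewrite sum_multiples //; have nz: 1 - z ^+ m != 0 by rewrite subr_eq0 eq_sym.
apply: (mulIf nz); rewrite divfK // mulrC exprM -[1 - _ ^+ q]opprB subrX1.
under eq_bigr do rewrite exprM.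
by rewrite -mulNr opprB.
Qed.

(** The coefficient of 'X^a is \sum_(m | gcd(a, n)) mu(m); exchanging the two sums
leaves one geometric series for each divisor m of n. *)
Lemma horner_fekete (F : fieldType) (z : F) n : squarefree n ->
    (forall m, (m %| n)%N -> z ^+ m != 1) ->
  (map_poly intr (fekete n)).[z]
    = (1 - z ^+ n) * \sum_(m <- divisors n) (moebius m)%:~R / (1 - z ^+ m).
Proof.
move=> sqf_n z_neq1; have n_gt0 := squarefree_gt0 sqf_n.
rewrite /fekete rmorph_sum horner_sum /= big_mkcond /=.
transitivity (\sum_(a < n) \sum_(m <- divisors n | (m %| a)%N)
                (moebius m)%:~R * z ^+ a).
  apply: eq_bigr => a _; rewrite -mulr_suml -(rmorph_sum intr) /=.
  rewrite -coprime_sum_moebius // map_polyXn hornerXn.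
  by case: coprime; rewrite ?mul1r ?mul0r.
rewrite (exchange_big_dep xpredT) //= mulr_sumr; apply: eq_big_seq => m.
rewrite -dvdn_divisors // => m_dvd_n.
by rewrite -mulr_sumr sum_expr_multiples ?z_neq1 // mulrCA.
Qed.

(** * Divisibility by cyclotomic polynomials *)

(** Divisibility holds over the integers because 'Phi_d is monic: the remainder of
the division of p by 'Phi_d has integer coefficients, vanishes at z, and is
smaller than the minimal polynomial of z. *)
Lemma Cyclotomic_dvd d (z : algC) (p : {poly int}) :
  d.-primitive_root z -> root (map_poly intr p) z -> zpoly_dvd 'Phi_d p.
Proof.
move=> prim_z pz0; have mon := Cyclotomic_monic d.
exists (Pdiv.Ring.rdivp p 'Phi_d); rewrite mulrC.
have Dp := Pdiv.RingMonic.rdivp_eq mon p.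
set r := Pdiv.Ring.rmodp p 'Phi_d in Dp.
suff r0 : r = 0 by rewrite {1}Dp r0 addr0.
have rz0 : root (map_poly intr r) z.
  move: pz0; rewrite {1}Dp rmorphD rmorphM /= (Cintr_Cyclotomic prim_z).
  have /rootP Phiz0 : root (cyclotomic z d) z by rewrite root_cyclotomic.
  by rewrite !rootE hornerD hornerM Phiz0 mulr0 add0r.
apply/eqP; apply: contraTT rz0 => r_neq0.
have := Pdiv.Ring.ltn_rmodpN0 p (monic_neq0 mon); rewrite -/r => lt_r.
apply/negP => rz0.
have [pq [Dpq mon_pq] pqP] := minCpolyP z.
have Dr : map_poly intr r
          = map_poly ratr (map_poly intr r : {poly rat}) :> {poly algC}.
  by rewrite -map_poly_comp; apply: eq_map_poly => c; rewrite /= rmorph_int.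
move: rz0; rewrite Dr pqP => /dvdp_leq; rewrite map_poly_eq0_id0; last first.
  by rewrite intr_eq0 lead_coef_eq0.
move=> /(_ r_neq0); rewrite leqNgt => /negP[].
rewrite (size_map_inj_poly intr_inj) //; apply: (leq_trans lt_r).
rewrite -(size_map_poly (@ratr algC) pq) -Dpq (minCpoly_cyclotomic prim_z).
by rewrite -(Cintr_Cyclotomic prim_z) (size_map_inj_poly intr_inj).
Qed.

(** * Cancellation along a pairing *)

Lemma moebius_signs m n : squarefree m -> squarefree n ->
  (moebius m = moebius n /\ moebius m * moebius n = 1)
  \/ (moebius m = - moebius n /\ moebius m * moebius n = -1).
Proof.
move=> sm sn; rewrite !moebius_squarefree // -(signr_odd _ (size (primes m))).
rewrite -(signr_odd _ (size (primes n))).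
by case: odd; case: odd; [left | right | right | left].
Qed.

(** The shift by 2^-1 makes the contribution of a pair vanish whatever the signs:
if x' y' = 1, where x' = w ^+ x and y' = w ^+ y, then
1 / (1 - x') + 1 / (1 - y') = 1. *)
Lemma pair_cancel (F : numFieldType) (w : F) d x y :
    squarefree x -> squarefree y -> w ^+ d = 1 -> w ^+ x != 1 -> w ^+ y != 1 ->
    (d%:Z %| x%:Z + moebius x * moebius y * y%:Z)%Z ->
  (moebius x)%:~R * ((1 - w ^+ x)^-1 - 2^-1)
    + (moebius y)%:~R * ((1 - w ^+ y)^-1 - 2^-1) = 0.
Proof.
move=> sx sy wd wx wy.
have nz : 1 - w ^+ x != 0 /\ 1 - w ^+ y != 0.
  by rewrite !subr_eq0 ![1 == _]eq_sym.
case: nz => nzx nzy.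
(* Equal signs: d divides x + y. Opposite signs: x and y agree modulo d. *)
have [[-> ->] | [-> ->]] := moebius_signs sx sy.
  rewrite mul1r -PoszD dvdzE !absz_nat => /dvdnP[k Dk].
  have wxy : w ^+ x * w ^+ y = 1 by rewrite -exprD Dk mulnC exprM wd expr1n.
  rewrite -mulrDr.
  suff -> : (1 - w ^+ x)^-1 - 2^-1 + ((1 - w ^+ y)^-1 - 2^-1) = 0.
    by rewrite mulr0.
  suff -> : (1 - w ^+ y)^-1 = 1 - (1 - w ^+ x)^-1 by field; rewrite nzx.
  apply: (mulIf nzy); rewrite mulVf //.
  apply: (mulIf nzx); rewrite mulrAC mulrBl mul1r mulVf //.
  have -> : (1 - w ^+ x - 1) * (1 - w ^+ y) = w ^+ x * w ^+ y - w ^+ x by ring.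
  by rewrite wxy.
rewrite mulN1r -eqz_mod_dvd => /eqP; rewrite !modz_nat => -[eq_xy].
by rewrite -(expr_mod x wd) -(expr_mod y wd) eq_xy rmorphN mulNr addNr.
Qed.

Lemma sum_pairing_eq0 (F : numFieldType) (w : F) N l (a b : 'I_l -> 'I_N.+1) T d :
    squarefree N -> (1 < N)%N -> divisor_pairing a b T ->
    (d%:Z %| pairing_gcd a b)%Z -> w ^+ d = 1 ->
    (forall e, (e %| N)%N -> w ^+ e != 1) ->
  \sum_(e <- divisors N) (moebius e)%:~R / (1 - w ^+ e) = 0.
Proof.
move=> sqf_N N_gt1 prs d_dvd wd w_neq1; have N_gt0 := ltnW N_gt1.
pose h e : F := (moebius e)%:~R * ((1 - w ^+ e)^-1 - 2^-1).
have h0 : \sum_(e <- divisors N) h e = 0.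
  rewrite -sum_divisor_set // (sum_pairing (fun e : 'I_N.+1 => h e) prs).
  apply: big1 => i _; have [aN bN] := pairing_dvd i prs.
  apply: pair_cancel wd _ _ (dvdz_trans d_dvd (pairing_gcd_dvd a b i));
    rewrite ?w_neq1 //; exact: squarefree_dvd sqf_N.
rewrite -[RHS]h0 /h; under [RHS]eq_bigr do rewrite mulrBr.
rewrite sumrB -mulr_suml -(rmorph_sum intr) /= sum_moebius //.
by rewrite gtn_eqF // mul0r subr0.
Qed.

Theorem theorem2p19 (n N l : nat) (T : {set {set 'I_N.+1}})
    (a b : 'I_l -> 'I_N.+1) (d : nat)
    (n_gt0 : (0 < n)%N) (n_sqf : squarefree n)
    (N_gt1 : (1 < N)%N) (N_dvd_n : (N %| n)%N)
    (T_pairs : divisor_pairing a b T)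
    (d_gt0 : (0 < d)%N) (d_dvd_D : (d%:Z %| pairing_gcd a b)%Z)
    (d_ndvd_n : ~~ (d %| n)%N) :
  zpoly_dvd 'Phi_d (fekete n).
Proof.
have [z prim_z] := C_prim_root_exists d_gt0.
apply: (Cyclotomic_dvd prim_z).
have z_neq1 m : (m %| n)%N -> z ^+ m != 1.
  move=> m_dvd_n; rewrite -(prim_order_dvd prim_z).
  by apply: contra d_ndvd_n => /dvdn_trans; apply.
rewrite rootE horner_fekete //.
have [M Dn] := dvdnP N_dvd_n; have co_MN : coprime M N.
  by apply: squarefree_coprime; rewrite -Dn.
have M_gt0 : (0 < M)%N by move: n_gt0; rewrite Dn; case: (M).
rewrite {2}Dn sum_divisorsM ?(ltnW N_gt1) // big1_seq ?mulr0 // => f /andP[_].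
rewrite -dvdn_divisors // => f_dvd_M.
(* The inner sum for f, at the root of unity z ^+ f. *)
transitivity ((moebius f)%:~R *
    \sum_(e <- divisors N) (moebius e)%:~R / (1 - (z ^+ f) ^+ e)).
  rewrite mulr_sumr; apply: eq_big_seq => e.
  rewrite -dvdn_divisors ?(ltnW N_gt1) // => e_dvd_N.
  rewrite moebiusM ?rmorphM -?exprM ?mulrA //.
  by apply: squarefree_dvd n_sqf; rewrite Dn dvdn_mul.
rewrite (sum_pairing_eq0 _ N_gt1 T_pairs d_dvd_D) ?mulr0 //.
- exact: squarefree_dvd n_sqf.
- by rewrite exprAC (prim_expr_order prim_z) expr1n.
- by move=> e e_dvd_N; rewrite -exprM z_neq1 // Dn dvdn_mul.
Qed.
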